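(* Let $\Omega\subset\mathbb{R}$, $T>0$, and let $u$ be the solution of $$u_t=-\Delta^2u \text{ in } \Omega\times(0,T],\qquad \partial_\nu u=0=\partial_\nu(\Delta u)\text{ on }\partial\Omega\times(0,T],\qquad u(x,0)=u_0(x),\ x\in\Omega .$$ Let $|\alpha|<1$ and let $\{u^k\}_{k\ge1}$ be the functions generated from an initial guess $u^0$ by the PinT iteration $$u^k_t=-\Delta^2u^k \text{ in } \Omega\times(0,T],\qquad u^k(x,0)=\alpha u^k(x,T)-\alpha u^{k-1}(x,T)+u_0(x),\ x\in\Omega,\qquad \partial_\nu u^k=0=\partial_\nu(\Delta u^k)\text{ on }\partial\Omega\times(0,T].$$ Then the error function $e^k(x,t)=u^k(x,t)-u(x,t)$ satisfies the linear convergence estimate $$\| e^k \|_{L^{\infty}(0, T;L^2(\Omega))} \leq \left(\frac{|\alpha| e^{-\omega_{\min}^4 T}}{1-|\alpha| e^{-\omega_{\min}^4 T}} \right) ^k \| e^0 \|_{L^{\infty}(0, T;L^2(\Omega))},$$ where $\omega_{\min}$ is the lowest Fourier frequency.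
   Context: $\Omega$ is a bounded interval and $\nu$ is the outward unit normal to $\partial\Omega$. $k\ge 1$ is the iteration index and $\alpha$ is a real free parameter. Fourier frequencies $\omega$ are those of the Fourier representation in the space variable (compatible with the boundary conditions), in which $\Delta$ acts on the mode of frequency $\omega$ as multiplication by $-\omega^2$ (so $\Delta^2$ acts as $\omega^4$); $\omega_{\min}$ is the smallest of these frequencies in absolute value. *)

(* Defs.v *)
From HB Require Import structures.
From mathcomp Require Import all_boot all_order all_algebra.
From mathcomp Require Import all_classical all_reals all_analysis.

Set Implicit Arguments.
Unset Strict Implicit.
Unset Printing Implicit Defensive.

Import Order.TTheory GRing.Theory Num.Theory.
Import numFieldNormedType.Exports.

Local Open Scope classical_set_scope.
Local Open Scope ring_scope.

(* Derivative relative to a set D: two-sided at interior points of D, one-sided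
   at the endpoints when D is an interval.  Only meaningful under
   [derivable_within]. *)
Definition dslope (R : realType) (f : R -> R) (x : R) : R -> R :=
  fun y => (y - x)^-1 * (f y - f x).

Definition derivable_within (R : realType) (D : set R) (f : R -> R) (x : R) :
  Prop := cvg (dslope f x y @[y --> within D x^']).

Definition derive_within (R : realType) (D : set R) (f : R -> R) (x : R) : R :=
  lim (dslope f x y @[y --> within D x^']).

(* Omega = ]a, b[. *)
Definition Dx (R : realType) (a b : R) (f : R -> R) : R -> R :=
  derive_within `[a, b] f.

Definition laplacian (R : realType) (a b : R) (f : R -> R) : R -> R :=
  Dx a b (Dx a b f).

Definition outward_normal (R : realType) (a b x : R) : R :=
  if x == a then -1 else 1.

Definition normal_derivative (R : realType) (a b : R) (f : R -> R) (x : R) : R :=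
  outward_normal a b x * Dx a b f x.

Definition biharmonic_neumann (R : realType) (a b : R) (f : R -> R) : Prop :=
  forall x, x = a \/ x = b ->
    normal_derivative a b f x = 0 /\
    normal_derivative a b (laplacian a b f) x = 0.

Definition Cn_closed (R : realType) (a b : R) (n : nat) (f : R -> R) : Prop :=
  (forall i, (i < n)%N -> forall x, x \in `[a, b] ->
     derivable_within `[a, b] (iter i (Dx a b) f) x) /\
  (forall i, (i <= n)%N -> {within `[a, b], continuous (iter i (Dx a b) f)}).

Definition fourier_mode (R : realType) (a b omega : R) (phi : R -> R) : Prop :=
  [/\ Cn_closed a b 4 phi,
      exists2 x, x \in `]a, b[ & phi x != 0,
      forall x, x \in `]a, b[ -> laplacian a b phi x = - omega ^+ 2 * phi x
    & biharmonic_neumann a b phi].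

Definition fourier_frequency (R : realType) (a b omega : R) : Prop :=
  exists phi : R -> R, fourier_mode a b omega phi.

Definition lowest_fourier_frequency (R : realType) (a b omega : R) : Prop :=
  fourier_frequency a b omega /\
  forall omega', fourier_frequency a b omega' -> `|omega| <= `|omega'|.

(* [f \_ D] extends f by 0 outside D. *)
Definition inL2 (R : realType) (a b : R) (f : R -> R) : Prop :=
  f \_ `]a, b[ \in Lfun (@lebesgue_measure R) 2%:E.

Definition L2norm (R : realType) (a b : R) (f : R -> R) : \bar R :=
  Lnorm (@lebesgue_measure R) 2%:E (EFin \o f \_ `]a, b[).

Definition LinftyL2norm (R : realType) (a b T : R) (v : R -> R -> R) : \bar R :=
  Lnorm (@lebesgue_measure R) +oo%E ((fun t => L2norm a b (v t)) \_ `]0, T[).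

Definition L2cvg (R : realType) (a b : R) (F : set_system R)
    (v : R -> R -> R) (g : R -> R) : Prop :=
  L2norm a b (fun x => v t x - g x) @[t --> F] --> 0%E.

(* v in C([0, T]; L^2(Omega)) *)
Definition continuous_L2 (R : realType) (a b T : R) (v : R -> R -> R) : Prop :=
  (forall t, t \in `[0, T] -> inL2 a b (v t)) /\
  (forall t, t \in `[0, T] -> L2cvg a b (within `[0, T] (nbhs t)) v (v t)).

Definition Dt (R : realType) (T : R) (v : R -> R -> R) (t x : R) : R :=
  derive_within `]0, T] (fun s => v s x) t.

Definition jointly_continuous (R : realType) (a b T : R) (v : R -> R -> R) :
  Prop := {within `]0, T] `*` `[a, b], continuous (fun p : R * R => v p.1 p.2)}.

(* C^1 in time and C^4 in space on ]0, T] x [a, b]; nothing is required at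
   t = 0, so that every initial datum in L^2(Omega) is covered. *)
Definition parabolic_regular (R : realType) (a b T : R) (v : R -> R -> R) :
  Prop :=
  [/\ forall t x, t \in `]0, T] -> x \in `[a, b] ->
        derivable_within `]0, T] (fun s => v s x) t,
      jointly_continuous a b T (Dt T v),
      forall t, t \in `]0, T] -> Cn_closed a b 4 (v t)
    & forall i, (i <= 4)%N ->
        jointly_continuous a b T (fun t => iter i (Dx a b) (v t))].

(* Values v t x, time first.  The initial datum g is attained in C([0, T]; L^2),
   hence almost everywhere. *)
Definition biharmonic_heat_solution (R : realType) (a b T : R) (g : R -> R)
    (v : R -> R -> R) : Prop :=
  [/\ parabolic_regular a b T v,
      continuous_L2 a b T v,
      forall t x, t \in `]0, T] -> x \in `]a, b[ ->
        Dt T v t x = - laplacian a b (laplacian a b (v t)) x,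
      forall t, t \in `]0, T] -> biharmonic_neumann a b (v t)
    & {ae @lebesgue_measure R, forall x, x \in `]a, b[ -> v 0 x = g x}].

(* The iteration only uses the trace of the initial guess at time T, so the
   guess need not be a solution nor continuous away from T. *)
Definition initial_guess (R : realType) (a b T : R) (v : R -> R -> R) : Prop :=
  (forall t, t \in `]0, T] -> inL2 a b (v t)) /\ L2cvg a b T^'- v (v T).

Definition pint_iteration (R : realType) (a b T alpha : R) (u0 : R -> R)
    (uk : nat -> R -> R -> R) : Prop :=
  initial_guess a b T (uk 0%N) /\
  forall k, (1 <= k)%N ->
    biharmonic_heat_solution a b T
      (fun x => alpha * uk k T x - alpha * uk k.-1 T x + u0 x) (uk k).

(* Main.v *)
Require Import Defs.
From mathcomp Require Import all_boot all_order all_algebra.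
From mathcomp Require Import all_classical all_reals all_analysis.
From mathcomp Require Import measurable_realfun ess_sup_inf ring lra.

Import Order.TTheory GRing.Theory Num.Theory.
Import numFieldNormedType.Exports.
Local Open Scope classical_set_scope.
Local Open Scope ring_scope.

(** The constant functions satisfy both Neumann conditions, so the lowest
    Fourier frequency of this problem is 0, the exponential factor is 1 and the
    claimed rate is [|alpha| / (1 - |alpha|)] ([lowest_fourier_frequency_eq0]).
    Hence no expansion in Fourier modes is needed: it suffices that the L2 norm
    of a solution never increases, which is an energy argument.

    By linearity ([biharmonic_heat_solutionB]) each error [e_k] solves the
    homogeneous equation, with
    [e_k(0) = alpha (e_k(T) - e_(k-1)(T))] almost everywhere.  For a solution
    [v], two integrations by parts, whose boundary terms vanish by the Neumann
    conditions, give
    [d/dt ||v||^2 = 2 int v v_t = - 2 int v v_xxxx = - 2 int (v_xx)^2 <= 0]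
    ([is_derive_energy], [neumann_Green], [energy_dissipation]).  This holds on
    the open time interval; continuity in time with values in L2 extends the
    monotonicity of the norm to both end points ([L2norm_nonincreasing]), in
    particular to [t = 0], where the solution need not be smooth.  Therefore
    [||e_k(0)|| <= |alpha| (||e_k(0)|| + ||e_(k-1)(T)||)], that is
    [||e_k(t)|| <= |alpha| / (1 - |alpha|) ||e_(k-1)(T)||] for all [t]
    ([relaxation_contraction]).

    Iterating bounds every [||e_k(t)||] by the k-th power of the rate times
    [||e_0(T)||], and left continuity at [T] bounds this trace by the essential
    supremum over time ([L2norm_final_le]). *)

(** * Derivatives relative to a set *)

(** The limit that defines a relative derivative is unique only at limit points
    of the set; this covers every point of an interval, end points included. *)
Lemma within_dnbhs_proper (R : realType) (u v : R) (D : set R) (x : R) :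
  u < v -> `]u, v[ `<=` D -> x \in `[u, v] -> ProperFilter (within D x^').
Proof.
move=> uv uvD; rewrite in_itv/= => /andP[ux xv].
suff [F PF [FD Fx]] : exists2 F : set_system R, ProperFilter F & F D /\ F --> x^'.
  split; last exact: within_filter.
  move=> W; apply: (@filter_not_empty _ F); have {}W := Fx _ W.
  by apply: filterS2 FD W => y Dy; apply.
have [xltv|vlex] := ltP x v.
  exists (x^'+); [exact: at_right_proper_filter|split; last first].
    by apply: within_subset => y /=; rewrite neq_lt => ->; rewrite orbT.
  near=> y; apply: uvD; rewrite /= in_itv/=; apply/andP; split.
    by rewrite (le_lt_trans ux)//; near: y; exact: nbhs_right_gt.
  by near: y; exact: nbhs_right_lt.
exists (x^'-); [exact: at_left_proper_filter|split; last first].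
  by apply: within_subset => y /=; rewrite neq_lt => ->.
near=> y; apply: uvD; rewrite /= in_itv/=; apply/andP; split.
  by near: y; apply: nbhs_left_gt; rewrite (lt_le_trans uv).
by rewrite (lt_le_trans _ xv)//; near: y; exact: nbhs_left_lt.
Unshelve. all: by end_near. Qed.

Lemma derive_withinP (R : realType) (D : set R) (f : R -> R) (x l : R) :
  ProperFilter (within D x^') ->
  dslope f x y @[y --> within D x^'] --> l ->
  derivable_within D f x /\ derive_within D f x = l.
Proof.
move=> PF fl; split; first by apply/cvg_ex; exists l.
by apply/cvg_lim.
Qed.

(** [h] need only agree with [f - g] on [D]: outside a closed [D] a relative
    derivative is a limit along the trivial filter, so linearity of the iterated
    derivatives is available on [D] alone. *)
Lemma dslope_withinB {R : realType} {D : set R} {f g h : R -> R} {x : R} :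
  D x -> ProperFilter (within D x^') -> {in D, forall y, h y = f y - g y} ->
  derivable_within D f x -> derivable_within D g x ->
  dslope h x y @[y --> within D x^'] -->
    derive_within D f x - derive_within D g x.
Proof.
move=> Dx PF hfg fx gx.
have : (fun y => dslope f x y - dslope g x y) y @[y --> within D x^'] -->
    derive_within D f x - derive_within D g x by exact: cvgB.
apply: cvg_trans; apply: fmap_within_eq => y yD.
by rewrite /dslope (hfg _ yD) (hfg _ (mem_set Dx)); ring.
Qed.

Lemma derivable_withinB {R : realType} {D : set R} {f g h : R -> R} {x : R} :
  D x -> ProperFilter (within D x^') -> {in D, forall y, h y = f y - g y} ->
  derivable_within D f x -> derivable_within D g x ->
  derivable_within D h x /\
  derive_within D h x = derive_within D f x - derive_within D g x.
Proof.
by move=> Dx PF hfg fx gx; apply: derive_withinP; exact: dslope_withinB.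
Qed.

Lemma derivable_within_interior (R : realType) (D : set R) (f : R -> R) (x : R) :
  nbhs x D -> derivable_within D f x -> is_derive x 1 f (derive_within D f x).
Proof.
move=> xD fx.
have {}fx : dslope f x y @[y --> x^'] --> derive_within D f x.
  apply: cvg_trans fx => A /=; rewrite /fmap /within /dnbhs/= => HA.
  rewrite /within/= in HA *.
  by apply: filterS2 xD HA => y Dy H ?; exact: H.
have h : h^-1 *: ((f \o shift x) h - f x) @[h --> 0^'] --> derive_within D f x.
  apply/cvgr_dnbhsP => w [w0 w_0].
  have /(_ _) := (cvgr_dnbhsP _ _ _).1 fx (fun n => w n + x).
  have -> : (fun n => dslope f x (w n + x)) =
      (fun n => (w n)^-1 *: ((f \o shift x) (w n) - f x)).
    by apply/funext => n; rewrite /dslope /= addrK.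
  apply; split => [n|]; first by rewrite -subr_eq0 addrK.
  by rewrite -[X in _ --> X]add0r; apply: cvgD => //; exact: cvg_cst.
apply: DeriveDef.
  by apply/cvg_ex; exists (derive_within D f x); under eq_fun do rewrite scaler1.
by rewrite /derive; apply/cvg_lim => //; under eq_fun do rewrite scaler1.
Qed.

(** * Linearity of the regularity classes *)

Section superposition.
Context {R : realType} {a b T : R}.
Hypotheses (ab : a < b) (T0 : 0 < T).

Let segment_proper {x} : x \in `[a, b] -> ProperFilter (within `[a, b] x^').
Proof. by apply: within_dnbhs_proper ab _; exact: subset_itv_oo_cc. Qed.

Let time_proper {t} : t \in `]0, T] -> ProperFilter (within `]0, T] t^').
Proof.
move=> t0T; apply: within_dnbhs_proper T0 _ _; first exact: subset_itv_oo_oc.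
exact: subset_itv_oc_cc.
Qed.

Lemma Dx_iterB {n} {f g : R -> R} : Cn_closed a b n f -> Cn_closed a b n g ->
  forall i, (i <= n)%N -> {in `[a, b]%classic, forall x,
    iter i (Dx a b) (f \- g) x = iter i (Dx a b) f x - iter i (Dx a b) g x}.
Proof.
move=> [df _] [dg _]; elim=> [//|i IH] ilen x xab.
have ab_x : x \in `[a, b] by rewrite inE in xab.
exact: (derivable_withinB ab_x (segment_proper ab_x)
  (IH (ltnW ilen)) (df _ ilen _ ab_x) (dg _ ilen _ ab_x)).2.
Qed.

Lemma Cn_closedB {n} {f g : R -> R} : Cn_closed a b n f -> Cn_closed a b n g ->
  Cn_closed a b n (f \- g).
Proof.
move=> Cf Cg; split=> i ilen.
  move=> x xab; have [df _] := Cf; have [dg _] := Cg.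
  by have [] := derivable_withinB xab (segment_proper xab)
    (Dx_iterB Cf Cg _ (ltnW ilen)) (df _ ilen _ xab) (dg _ ilen _ xab).
apply: (@subspace_eq_continuous _ _ _
  (fun x => iter i (Dx a b) f x - iter i (Dx a b) g x)).
  by move=> x xab; rewrite -(Dx_iterB Cf Cg).
by move=> x; apply: cvgB; [exact: Cf.2|exact: Cg.2].
Qed.

Lemma DtB {v w : R -> R -> R} : parabolic_regular a b T v ->
  parabolic_regular a b T w ->
  forall {t x}, t \in `]0, T] -> x \in `[a, b] ->
  derivable_within `]0, T] (fun s => v s x - w s x) t /\
  Dt T (fun s => v s \- w s) t x = Dt T v t x - Dt T w t x.
Proof.
move=> [dv _ _ _] [dw _ _ _] t x t0T xab.
exact: (derivable_withinB t0T (time_proper t0T) _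
  (dv _ _ t0T xab) (dw _ _ t0T xab)).
Qed.

Lemma parabolic_regularB {v w : R -> R -> R} :
  parabolic_regular a b T v -> parabolic_regular a b T w ->
  parabolic_regular a b T (fun t => v t \- w t).
Proof.
move=> rv rw; have [dv cDv Cv cv] := rv; have [dw cDw Cw cw] := rw.
split=> [t x t0T xab||t t0T|i i4].
- by have [] := DtB rv rw t0T xab.
- apply: (@subspace_eq_continuous _ _ _
    (fun p : R * R => Dt T v p.1 p.2 - Dt T w p.1 p.2)).
    move=> -[t x]; rewrite inE => -[/= t0T xab].
    exact: esym (DtB rv rw t0T xab).2.
  by move=> p; apply: cvgB; [exact: cDv|exact: cDw].
- by apply: Cn_closedB; [exact: Cv|exact: Cw].
- apply: (@subspace_eq_continuous _ _ _ (fun p : R * R =>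
    iter i (Dx a b) (v p.1) p.2 - iter i (Dx a b) (w p.1) p.2)).
    move=> -[t x]; rewrite inE => -[/= t0T xab].
    exact: esym (Dx_iterB (Cv _ t0T) (Cw _ t0T) _ i4 _ (mem_set xab)).
  by move=> p; apply: cvgB; [exact: cv|exact: cw].
Qed.

End superposition.

(** * The L2 norm on a bounded interval *)

Lemma ae_eq_Lnorm d (S : measurableType d) (R : realType)
    (mu : {measure set S -> \bar R}) (r : R) (f g : S -> R) :
  measurable_fun setT f -> measurable_fun setT g ->
  {ae mu, forall x, f x = g x} ->
  Lnorm mu r%:E (EFin \o f) = Lnorm mu r%:E (EFin \o g).
Proof.
move=> mf mg fg; rewrite unlock; congr poweR.
have mL (h : S -> R) : measurable_fun setT h ->
    measurable_fun setT (fun x => `|(EFin \o h) x| `^ r)%E.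
  move=> mh; apply: (measurableT_comp (measurable_poweR _)) => //.
  by apply: measurableT_comp => //; exact/measurable_EFinP.
apply: ge0_ae_eq_integral => //; first exact: mL.
- exact: mL.
- by move=> x _; exact: poweR_ge0.
- by move=> x _; exact: poweR_ge0.
- by apply: filterS fg => x fgx _ /=; rewrite fgx.
Qed.

Section L2.
Context {R : realType} {a b : R}.
Local Notation mu := (@lebesgue_measure R).
Implicit Types f g h : R -> R.

Let two_ge1 : (1 <= 2%:E :> \bar R)%E.
Proof. by rewrite lee_fin ler1n. Qed.

Lemma inL2_lincomb {f g} c : inL2 a b f -> inL2 a b g -> inL2 a b (c \*: f \+ g).
Proof.
move=> fL gL; rewrite /inL2.
have -> : (c \*: f \+ g) \_ `]a, b[ = c *: (f \_ `]a, b[) + (g \_ `]a, b[).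
  apply/funext => x; rewrite /= !fctE patchE [in RHS]patchE [X in _ + X]patchE.
  by case: ifPn => // _; rewrite scaler0 addr0.
by apply: (Lfun_submod_closed _ two_ge1).2.
Qed.

Lemma inL2Z {f} c : inL2 a b f -> inL2 a b (c \*: f).
Proof.
move=> fL; suff -> : c \*: f = (c - 1) \*: f \+ f by exact: inL2_lincomb.
by apply/funext => x /=; rewrite scalerBl scale1r subrK.
Qed.

Lemma inL2B {f g} : inL2 a b f -> inL2 a b g -> inL2 a b (f \- g).
Proof.
move=> fL gL; suff -> : f \- g = (-1) \*: g \+ f by exact: inL2_lincomb.
by apply/funext => x /=; rewrite scaleN1r addrC.
Qed.

Lemma L2norm_ge0 f : (0 <= L2norm a b f)%E.
Proof. exact: Lnorm_ge0. Qed.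

Lemma L2norm_lty {f} : inL2 a b f -> (L2norm a b f < +oo)%E.
Proof. by move=> /sub_Lfun_finLfun; rewrite inE. Qed.

Lemma L2norm_fin_num {f} : inL2 a b f -> L2norm a b f \is a fin_num.
Proof. by move=> fL; rewrite ge0_fin_numE ?L2norm_ge0// L2norm_lty. Qed.

Lemma inL2_measurable {f} : inL2 a b f -> measurable_fun setT (f \_ `]a, b[).
Proof. by move=> /sub_Lfun_mfun; rewrite inE. Qed.

Lemma L2normN f : L2norm a b (fun x => - f x) = L2norm a b f.
Proof.
rewrite /L2norm -[RHS]oppe_Lnorm; apply: eq_Lnorm => x /=.
by rewrite !patchE; case: ifPn => // _; rewrite oppr0.
Qed.

Lemma L2normBC f g : L2norm a b (f \- g) = L2norm a b (g \- f).
Proof.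
by rewrite -L2normN; congr (L2norm a b _); apply/funext => x /=; rewrite opprB.
Qed.

Lemma L2normD {f g} : inL2 a b f -> inL2 a b g ->
  (L2norm a b (f \+ g)%R <= L2norm a b f + L2norm a b g)%E.
Proof.
move=> fL gL; rewrite /L2norm.
rewrite (_ : (f \+ g) \_ _ = (f \_ `]a, b[ \+ g \_ `]a, b[)); last first.
  apply/funext => x; rewrite /= patchE [in RHS]patchE [X in _ + X]patchE.
  by case: ifPn => // _; rewrite addr0.
by apply: eminkowski => //; exact: inL2_measurable.
Qed.

Lemma L2normB {f g} : inL2 a b f -> inL2 a b g ->
  (L2norm a b (f \- g)%R <= L2norm a b f + L2norm a b g)%E.
Proof.
move=> fL gL; rewrite -(L2normN g); apply: L2normD => //.
suff -> : (fun x => - g x) = (g \- g) \- g by apply: inL2B => //; exact: inL2B.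
by apply/funext => x /=; rewrite subrr sub0r.
Qed.

Lemma L2norm_le_dist {f g} : inL2 a b f -> inL2 a b g ->
  (L2norm a b f <= L2norm a b g + L2norm a b (f \- g)%R)%E.
Proof.
move=> fL gL; have := L2normD gL (inL2B fL gL).
by rewrite (_ : g \+ (f \- g) = f)//; apply/funext => x /=; rewrite addrC subrK.
Qed.

Lemma L2normZ {f} c : inL2 a b f ->
  L2norm a b (c \*: f) = (`|c|%:E * L2norm a b f)%E.
Proof.
move=> fL; have := LnormZ (Lfun_Sub two_ge1 fL) c.
rewrite /L2norm /= => <-; apply: eq_Lnorm => x /=.
by rewrite !patchE; case: ifPn => // _; rewrite scaler0.
Qed.

Lemma L2norm_ae_eq {f g} : inL2 a b f -> inL2 a b g ->
  {ae mu, forall x, x \in `]a, b[ -> f x = g x} -> L2norm a b f = L2norm a b g.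
Proof.
move=> fL gL fg; apply: ae_eq_Lnorm; [exact: inL2_measurable..|].
apply: (@filterS _ _ (ae_filter_ringOfSetsType mu)) fg => x fgx; rewrite !patchE.
by case: ifPn => //; rewrite inE => xab; rewrite fgx.
Qed.

Lemma L2norm_sqr f : inL2 a b f ->
  ((fine (L2norm a b f)) ^+ 2)%:E = (\int[mu]_(x in `]a, b[) (f x ^+ 2)%:E)%E.
Proof.
move=> fL; rewrite EFin_expe fineK ?L2norm_fin_num//.
have : (L2norm a b f `^ 2 = \int[mu]_x (`|(EFin \o f \_ `]a, b[) x| `^ 2))%E.
  by apply: poweR_Lnorm; rewrite pnatr_eq0.
rewrite -{1}(fineK (L2norm_fin_num fL)) poweR_EFin.
rewrite powR_mulrn ?fine_ge0 ?L2norm_ge0//.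
rewrite EFin_expe fineK ?L2norm_fin_num// => ->.
rewrite [RHS]integral_mkcond; apply: eq_integral => x _ /=.
rewrite powR_mulrn// real_normK ?num_real// !patchE.
by case: ifPn => // _; rewrite expr0n.
Qed.
End L2.

(** * Green formula under Neumann conditions *)

Section dissipation.
Context {R : realType} {a b : R}.
Hypothesis ab : a < b.
Local Notation mu := (@lebesgue_measure R).

Lemma normal_derivative_eq0 (f : R -> R) x :
  normal_derivative a b f x = 0 -> Dx a b f x = 0.
Proof.
move=> /eqP; rewrite mulf_eq0 => /orP[|/eqP//].
by rewrite /outward_normal; case: ifP => _; rewrite ?oppr_eq0 oner_eq0.
Qed.

Lemma biharmonic_neumannE (f : R -> R) x : biharmonic_neumann a b f ->
  x = a \/ x = b -> iter 1 (Dx a b) f x = 0 /\ iter 3 (Dx a b) f x = 0.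
Proof.
by move=> nf /nf[f1 f3]; split; apply: normal_derivative_eq0.
Qed.

Lemma Cn_closed_is_derive {n} {f : R -> R} : Cn_closed a b n f ->
  forall i x, (i < n)%N -> x \in `]a, b[ ->
  is_derive x 1 (iter i (Dx a b) f) (iter i.+1 (Dx a b) f x).
Proof.
move=> [df _] i x ilen xab; apply: derivable_within_interior.
  by apply: filterS (near_in_itvoo xab) => y; exact: subset_itv_oo_cc.
by apply: df => //; exact: subset_itv_oo_cc.
Qed.

Lemma continuous_segment_integrable (f : R -> R) :
  {within `[a, b], continuous f} -> mu.-integrable `[a, b] (EFin \o f).
Proof. by apply: continuous_compact_integrable; exact: segment_compact. Qed.

(** [f f_4 - f_2^2] is the derivative of [f f_3 - f_1 f_2], where [f_i] is the
    i-th derivative, and the latter vanishes at both end points because [f_1] and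
    [f_3] do; a single use of the fundamental theorem of calculus thus replaces
    two integrations by parts. *)
Lemma neumann_Green (f : R -> R) : Cn_closed a b 4 f ->
  biharmonic_neumann a b f ->
  \int[mu]_(x in `[a, b]) (f x * iter 4 (Dx a b) f x) =
  \int[mu]_(x in `[a, b]) (iter 2 (Dx a b) f x ^+ 2).
Proof.
move=> Cf nf; set D := fun i => iter i (Dx a b) f.
have cD i : (i <= 4)%N -> {within `[a, b], continuous (D i)} by exact: Cf.2.
have c04 : {within `[a, b], continuous (fun x => f x * D 4 x)}.
  by move=> x; apply: cvgM; [exact: (cD 0%N)|exact: (cD 4%N)].
have c22 : {within `[a, b], continuous (fun x => D 2 x ^+ 2)}.
  by move=> x; apply: cvgM; exact: (cD 2%N).
pose F x := f x * D 3 x - D 1 x * D 2 x.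
have cF : {within `[a, b], continuous F}.
  move=> x; apply: cvgB; apply: cvgM; [exact: (cD 0%N)|exact: (cD 3%N)|
    exact: (cD 1%N)|exact: (cD 2%N)].
have dF x : x \in `]a, b[ -> is_derive x 1 F (f x * D 4 x - D 2 x ^+ 2).
  move=> xab; have d i : (i < 4)%N -> is_derive x 1 (D i) (D i.+1 x).
    by move=> i4; exact: (Cn_closed_is_derive Cf).
  have d0 : is_derive x 1 f (D 1 x) := d 0%N isT.
  have d1 := d 1%N isT; have d2 := d 2%N isT; have d3 := d 3%N isT.
  apply: is_derive_eq.
  rewrite -![_ *: _]/(_ * _); move: (f x) (D 1 x) (D 2 x) (D 3 x) (D 4 x).
  by move=> y0 y1 y2 y3 y4; ring.
have F0 x : x = a \/ x = b -> F x = 0.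
  by move=> /(biharmonic_neumannE _ _ nf)[D1 D3];
    rewrite /F /D D1 D3 mul0r mulr0 subrr.
have := continuous_FTC2 ab (f := fun x => f x * D 4 x - D 2 x ^+ 2) (F := F).
move=> /(_ _)/(_ _)/(_ _) FTC.
apply/eqP; rewrite -subr_eq0 -RintegralB//;
  try exact: continuous_segment_integrable.
rewrite /Rintegral FTC.
- by rewrite (F0 a (or_introl erefl)) (F0 b (or_intror erefl)) subee.
- by move=> x; apply: cvgB; [exact: c04|exact: c22].
- have [_ Fa Fb] := (continuous_within_itvP F ab).1 cF.
  split; [|exact: Fa|exact: Fb].
  by move=> x xab; apply: (@ex_derive _ _ _ _ _ _ _ (dF x xab)).
- by move=> x xab; rewrite derive1E; exact: (@derive_val _ _ _ _ _ _ _ (dF x xab)).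
Qed.

End dissipation.

(** * Differences of solutions *)

Section energy.
Context {R : realType} {a b T : R}.
Hypotheses (ab : a < b) (T0 : 0 < T).
Local Notation mu := (@lebesgue_measure R).
Implicit Types (v w : R -> R -> R) (f g : R -> R).

Lemma L2cvgB {F : set_system R} {FF : Filter F} {v w f g} :
  (\forall t \near F, inL2 a b (v t)) -> (\forall t \near F, inL2 a b (w t)) ->
  inL2 a b f -> inL2 a b g ->
  L2cvg a b F v f -> L2cvg a b F w g ->
  L2cvg a b F (fun t => v t \- w t) (f \- g).
Proof.
move=> vL wL fL gL vf wg; rewrite /L2cvg.
have vfwg : (L2norm a b (v t \- f)%R + L2norm a b (w t \- g)%R)%E @[t --> F] --> 0%E.
  by rewrite -[X in _ --> X]adde0; apply: cvgeD.
apply: (squeeze_cvge _ (cvg_cst 0%E) vfwg).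
near=> t; rewrite L2norm_ge0/=.
have vt : inL2 a b (v t) by near: t.
have wt : inL2 a b (w t) by near: t.
apply: le_trans (L2normB (inL2B vt fL) (inL2B wt gL)).
by rewrite le_eqVlt; apply/orP; left; apply/eqP; congr L2norm;
  apply/funext => x /=; ring.
Unshelve. all: by end_near. Qed.

Lemma biharmonic_heat_solutionB {v w f g} :
  biharmonic_heat_solution a b T f v -> biharmonic_heat_solution a b T g w ->
  biharmonic_heat_solution a b T (f \- g) (fun t => v t \- w t).
Proof.
move=> [rv [vL cv] eqv nv v0] [rw [wL cw] eqw nw w0].
have [_ _ Cv _] := rv; have [_ _ Cw _] := rw.
have DB t x i : t \in `]0, T] -> x \in `[a, b] -> (i <= 4)%N ->
    iter i (Dx a b) (v t \- w t) x =
    iter i (Dx a b) (v t) x - iter i (Dx a b) (w t) x.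
  by move=> t0T xab i4; apply: (Dx_iterB ab (Cv _ t0T) (Cw _ t0T)); rewrite ?inE.
split.
- exact: parabolic_regularB.
- split=> t t0T; first by apply: inL2B; [exact: vL|exact: wL].
  apply: L2cvgB; [| |exact: vL|exact: wL|exact: cv|exact: cw].
  + by near=> s; apply: vL; near: s; exact: withinT.
  + by near=> s; apply: wL; near: s; exact: withinT.
- move=> t x t0T xab.
  have xab' : x \in `[a, b] by exact: subset_itv_oo_cc.
  rewrite (DtB T0 rv rw t0T xab').2 (eqv _ _ t0T xab) (eqw _ _ t0T xab).
  have subNN (A B C : R) : C = A - B -> - A - - B = - C.
    by move=> ->; rewrite opprB opprK addrC.
  (* Abstracting the four-fold derivatives spares unfolding them when compared. *)
  exact: subNN (DB t x 4%N t0T xab' isT).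
- move=> t t0T x xab.
  have xab' : x \in `[a, b].
    by case: xab => ->; rewrite in_itv/= lexx ltW.
  have [v1 v3] := biharmonic_neumannE _ x (nv _ t0T) xab.
  have [w1 w3] := biharmonic_neumannE _ x (nw _ t0T) xab.
  have D1 := DB t x 1%N t0T xab' isT; rewrite v1 w1 subr0 in D1.
  have D3 := DB t x 3%N t0T xab' isT; rewrite v3 w3 subr0 in D3.
  by split; apply/eqP; rewrite mulf_eq0; apply/orP; right; apply/eqP;
    [exact: D1|exact: D3].
- apply: (@filterS2 _ _ (ae_filter_ringOfSetsType mu) _ _ _ _ v0 w0).
  by move=> x vx wx xab /=; rewrite vx// wx.
Unshelve. all: by end_near. Qed.

(** * Energy balance *)

(** Applied to [v] and to [v_t], this yields the constant that dominates the time
    derivative of the energy density in [is_derive_energy]. *)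
Lemma bounded_on_rectangle (F : R * R -> R) (s t : R) : 0 < s -> t < T ->
  {within `]0, T] `*` `[a, b], continuous F} ->
  exists M, forall r x, r \in `[s, t] -> x \in `[a, b] -> `|F (r, x)| <= M.
Proof.
move=> s0 tT cF.
have cK : compact (`[s, t]%classic `*` `[a, b]%classic).
  by apply: compact_setX; exact: segment_compact.
have : bounded_set (F @` (`[s, t] `*` `[a, b])).
  apply/compact_bounded/continuous_compact => //.
  apply: continuous_subspaceW cF => -[r x] /= [rst xab]; split => //=.
  move: rst; rewrite /= !in_itv/= => /andP[sr rt].
  by rewrite (lt_le_trans s0)//= (le_trans rt)// ltW.
move=> [M [_ /(_ (M + 1))]]; rewrite ltrDl ltr01 => /(_ isT) FM.
exists (M + 1) => r x rst xab; apply: FM => /=.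
by exists (r, x).
Qed.

(** Differentiation under the integral sign.  Regularity may fail at [t = 0], so
    domination is sought only for times in a neighbourhood of [t] that is bounded
    away from 0. *)
Lemma is_derive_energy {v} t : parabolic_regular a b T v -> t \in `]0, T[ ->
  is_derive t 1 (fun s => \int[mu]_(x in `[a, b]) (v s x ^+ 2))
    (\int[mu]_(x in `[a, b]) (2 * (v t x * Dt T v t x))).
Proof.
move=> [dv cDv Cv cv]; rewrite in_itv/= => /andP[t0 tT].
pose s := t / 2; pose r := (t + T) / 2.
have s0 : 0 < s by rewrite /s; lra.
have rT : r < T by rewrite /r; lra.
have str : t \in `]s, r[ by rewrite in_itv/= /s /r; apply/andP; split; lra.
have sub q : q \in `]s, r[ -> q \in `]0, T].
  by rewrite !in_itv/= => /andP[sq qr]; apply/andP; split; lra.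
have dsq q x : q \in `]s, r[ -> x \in `[a, b] ->
    is_derive q 1 (fun z => v z x ^+ 2) (2 * (v q x * Dt T v q x)).
  move=> qsr xab.
  have dq : is_derive q 1 (fun z => v z x) (Dt T v q x).
    apply: derivable_within_interior; last by apply: dv => //; exact: sub.
    by apply: filterS (near_in_itvoo qsr) => z; exact: sub.
  by apply: is_derive_eq; rewrite /GRing.scale /=; ring.
have [M vM] := bounded_on_rectangle _ _ _ s0 rT (cv 0%N isT).
have [M' DM] := bounded_on_rectangle _ _ _ s0 rT cDv.
pose G (_ : R) := 2 * (`|M| * `|M'|).
have intf q : q \in `]s, r[ ->
    mu.-integrable `[a, b] (EFin \o (fun x => v q x ^+ 2)).
  move=> qsr; apply: continuous_segment_integrable => x.
  by apply: cvgM; apply: (Cv q (sub q qsr)).2 0%N isT _.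
have derf q x : q \in `]s, r[ -> x \in `[a, b] ->
    derivable (fun z => v z x ^+ 2) q 1.
  by move=> qsr xab; have [] := dsq q x qsr xab.
have d1E q x : q \in `]s, r[ -> x \in `[a, b] ->
    partial1of2 (fun z y => v z y ^+ 2) q x = 2 * (v q x * Dt T v q x).
  by move=> qsr xab; rewrite partial1of2E; have [_ ->] := dsq q x qsr xab.
have G0 y : 0 <= G y by rewrite /G !mulr_ge0.
have intG : mu.-integrable `[a, b] (EFin \o G).
  by apply: continuous_segment_integrable => x; exact: cvg_cst.
have Gub q x : q \in `]s, r[ -> x \in `[a, b] ->
    `|partial1of2 (fun z y => v z y ^+ 2) q x| <= G x.
  move=> qsr xab; rewrite d1E// /G !normrM ger0_norm// ler_wpM2l// ler_pM//.
    by apply: le_trans (ler_norm _); apply: vM => //; exact: subset_itv_oo_cc.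
  by apply: le_trans (ler_norm _); apply: DM => //; exact: subset_itv_oo_cc.
apply: DeriveDef.
  by apply: (derivable_under_integral _ str intf derf G0 intG Gub).
rewrite -derive1E (differentiation_under_integral _ str intf derf G0 intG Gub)//.
by apply: eq_Rintegral => x; rewrite inE => xab; exact: d1E.
Qed.

(** The equation holds on the open interval only, whereas continuity and the Green
    formula concern the closed one. *)
Lemma Rintegral_eq_oo f g : (forall x, x \in `]a, b[ -> f x = g x) ->
  measurable_fun `]a, b[ (EFin \o g) ->
  \int[mu]_(x in `[a, b]) f x = \int[mu]_(x in `[a, b]) g x.
Proof.
move=> fg mg; congr fine.
have mf : measurable_fun `]a, b[ (EFin \o f).
  by apply: eq_measurable_fun mg => x; rewrite inE => xab /=; rewrite fg.
rewrite integral_itv_bndoo// [RHS]integral_itv_bndoo//.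
by apply: eq_integral => x; rewrite inE => xab /=; rewrite fg.
Qed.

(** The equation turns the integrand into [- 2 v v_xxxx], whose integral is
    [- 2 int (v_xx)^2] by [neumann_Green]. *)
Lemma energy_dissipation {v g} t : biharmonic_heat_solution a b T g v ->
  t \in `]0, T] -> \int[mu]_(x in `[a, b]) (2 * (v t x * Dt T v t x)) <= 0.
Proof.
move=> [[_ _ Cv _] _ eqv nv _] t0T.
have c4 := (Cv t t0T).2 4%N isT; have c0 := (Cv t t0T).2 0%N isT.
have iv4 : mu.-integrable `[a, b]
    (EFin \o (fun x => v t x * iter 4 (Dx a b) (v t) x)).
  apply: continuous_segment_integrable => x.
  by apply: cvgM; [exact: c0|exact: c4].
rewrite (_ : Rintegral _ _ _ =
    \int[mu]_(x in `[a, b]) (- 2 * (v t x * iter 4 (Dx a b) (v t) x))).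
  rewrite RintegralZl// neumann_Green//; [|exact: Cv|exact: nv].
  rewrite mulNr oppr_le0 mulr_ge0// Rintegral_ge0// => x _; exact: sqr_ge0.
apply: Rintegral_eq_oo => [x xab|].
  by rewrite eqv//= /laplacian; ring.
have /measurable_int/measurable_EFinP m4 := iv4.
apply/measurable_EFinP; apply: measurable_funS (_ : measurable_fun `[a, b] _) => //.
  exact: subset_itv_oo_cc.
by apply: measurable_funM.
Qed.

End energy.

(** * Decay of the L2 norm and traces in time *)

Section decay.
Context {R : realType} {a b T : R}.
Hypotheses (ab : a < b) (T0 : 0 < T).
Local Notation mu := (@lebesgue_measure R).
Implicit Types (v w : R -> R -> R) (f g : R -> R).

Lemma fine_L2norm_dist {f g} : inL2 a b f -> inL2 a b g ->
  `|fine (L2norm a b f) - fine (L2norm a b g)| <= fine (L2norm a b (f \- g)).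
Proof.
move=> fL gL; have := L2norm_le_dist fL gL; have := L2norm_le_dist gL fL.
rewrite L2normBC.
have fin h : inL2 a b h -> {r : R | L2norm a b h = r%:E}.
  by move=> hL; exists (fine (L2norm a b h)); rewrite fineK ?L2norm_fin_num.
have [p ->] := fin _ fL; have [q ->] := fin _ gL.
have [d ->] := fin _ (inL2B fL gL).
rewrite -!EFinD !lee_fin /= ler_norml => ? ?.
by apply/andP; split; lra.
Qed.

Lemma continuous_fine_L2norm v : continuous_L2 a b T v ->
  {within `[0, T], continuous (fun t => fine (L2norm a b (v t)))}.
Proof.
move=> [vL cv]; apply/subspace_continuousP => t /= t0T.
have := cv t t0T; rewrite /L2cvg => /fine_cvgP[_ /cvgr0Pnorm_lt dist0].
apply/cvgrPdist_lt => e e0; near=> s.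
have sL : inL2 a b (v s) by apply: vL; near: s; exact: withinT.
apply: le_lt_trans (fine_L2norm_dist (vL t t0T) sL) _.
rewrite L2normBC; apply: le_lt_trans (ler_norm _) _.
by near: s; exact: dist0.
Unshelve. all: by end_near. Qed.

Lemma L2norm_sqr_Rintegral f : Cn_closed a b 0 f -> inL2 a b f ->
  fine (L2norm a b f) ^+ 2 = \int[mu]_(x in `[a, b]) (f x ^+ 2).
Proof.
move=> Cf fL; apply: EFin_inj; rewrite L2norm_sqr//.
have cf2 : {within `[a, b], continuous (fun x => f x ^+ 2)}.
  by move=> x; apply: cvgM; exact: Cf.2 0%N isT _.
have if2 := continuous_segment_integrable _ cf2.
rewrite fineK; last exact: integrable_fin_num.
rewrite [RHS]integral_itv_bndoo//.
apply: measurable_funS (_ : measurable_fun `[a, b] _) => //.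
  exact: subset_itv_oo_cc.
exact: measurable_int if2.
Qed.

(** The energy has nonpositive derivative on the open time interval and is
    continuous on the closed one. *)
Lemma L2norm_nonincreasing {g v} t : biharmonic_heat_solution a b T g v ->
  t \in `[0, T] -> (L2norm a b (v t) <= L2norm a b (v 0%R))%E.
Proof.
move=> sv t0T; have [rv cL eqv nv _] := sv; have [vL _] := cL.
have [_ _ Cv _] := rv.
have z0T : 0 \in `[0, T] by rewrite in_itv/= lexx ltW.
pose E s := fine (L2norm a b (v s)) ^+ 2.
have EE s : s \in `]0, T[ -> E s = \int[mu]_(x in `[a, b]) (v s x ^+ 2).
  move=> s0T; rewrite /E L2norm_sqr_Rintegral//.
    split=> // i; rewrite leqn0 => /eqP ->.
    exact: (Cv s (subset_itv_oo_oc s0T)).2 0%N isT.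
  by apply: vL; exact: subset_itv_oo_cc.
have dE s : s \in `]0, T[ -> is_derive s 1 E
    (\int[mu]_(x in `[a, b]) (2 * (v s x * Dt T v s x))).
  move=> s0T; apply: near_eq_is_derive (is_derive_energy s rv s0T).
  by apply: filterS (near_in_itvoo s0T) => r r0T; rewrite EE.
have cE : {within `[0, T], continuous E}.
  by move=> s; apply: cvgM; exact: continuous_fine_L2norm.
have : E t <= E 0.
  apply: (ler0_derive1_le_cc (a := 0) (b := T)) => //.
  - by move=> s s0T; have [] := dE s s0T.
  - move=> s s0T; rewrite derive1E; have [_ ->] := dE s s0T.
    by apply: energy_dissipation sv _ => //; exact: subset_itv_oo_oc.
  - by move: t0T; rewrite in_itv/= => /andP[].
rewrite /E ler_sqr ?nnegrE ?fine_ge0 ?L2norm_ge0//.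
by rewrite -lee_fin !fineK ?L2norm_fin_num//; exact: vL.
Qed.

Lemma LinftyL2norm_le v (C : \bar R) : (0 <= C)%E ->
  (forall t, t \in `]0, T[ -> (L2norm a b (v t) <= C)%E) ->
  (LinftyL2norm a b T v <= C)%E.
Proof.
move=> C0 vC; rewrite /LinftyL2norm unlock; case: ifPn => // _.
apply/ess_supP; apply: nearW => t /=; rewrite patchE.
case: ifPn => [|_]; last by rewrite abse0.
by rewrite inE => t0T; rewrite gee0_abs ?L2norm_ge0// vC.
Qed.

Lemma lebesgue_measure_oo_gt0 (s t : R) : s < t -> (0 < mu `]s, t[)%E.
Proof.
by move=> st; rewrite lebesgue_measure_itv/= lte_fin st -EFinD lte_fin subr_gt0.
Qed.

Lemma lebesgue_measureT_gt0 : (0 < mu setT)%E.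
Proof.
apply: lt_le_trans (lebesgue_measure_oo_gt0 _ _ ltr01) _.
by apply: le_measure; rewrite ?inE.
Qed.

(** A left neighbourhood has positive measure, hence meets every set of full
    measure. *)
Lemma ae_at_left_ex (t : R) (P Q : set R) : {ae mu, forall s, P s} ->
  (\forall s \near t^'-, Q s) -> exists2 s, P s & Q s.
Proof.
move=> aeP [e /= e0 eQ]; apply: contrapT => PQ.
have te : t - e < t by rewrite ltrBlDr ltrDl.
have : mu.-negligible (`]t - e, t[ : set R).
  apply: negligibleS aeP => s /=; rewrite in_itv/= => /andP[tes st] Ps.
  apply: PQ; exists s => //; apply: eQ => //=.
  by rewrite gtr0_norm ?subr_gt0//; lra.
move/measure_negligible => /(_ (measurable_itv _)) mu0.
by have := lebesgue_measure_oo_gt0 _ _ te; rewrite [X in (_ < X)%E]mu0 ltxx.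
Qed.

(** Times close to [T] at which the essential bound holds exist by
    [ae_at_left_ex], and the norms there approach the one at [T]. *)
Lemma L2norm_final_le v : (forall t, t \in `]0, T] -> inL2 a b (v t)) ->
  L2cvg a b T^'- v (v T) -> (L2norm a b (v T) <= LinftyL2norm a b T v)%E.
Proof.
move=> vL vT; rewrite /LinftyL2norm unlock lebesgue_measureT_gt0.
set F := (fun t => L2norm a b (v t)) \_ `]0, T[.
apply/lee_addgt0Pr => e e0.
move: vT; rewrite /L2cvg => /fine_cvgP[_ /cvgr0Pnorm_lt /(_ e e0) dist].
have [s FM [s0T sT]] : exists2 s, ((abse \o F) s <= ess_sup mu (abse \o F))%E &
    (s \in `]0, T[) /\ `|fine (L2norm a b (v s \- v T))| < e.
  apply: (@ae_at_left_ex T) (ess_sup_ge mu (abse \o F)) _; near=> s; split.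
    rewrite in_itv/=; apply/andP; split; first by near: s; exact: nbhs_left_gt.
    by near: s; exact: nbhs_left_lt.
  by near: s.
have sL : inL2 a b (v s) by apply: vL; exact: subset_itv_oo_oc.
have TL : inL2 a b (v T) by apply: vL; rewrite in_itv/= T0 lexx.
apply: le_trans (L2norm_le_dist TL sL) _; rewrite L2normBC; apply: leeD.
  move: FM; rewrite /F /= patchE mem_set// gee0_abs ?L2norm_ge0//.
rewrite -(fineK (L2norm_fin_num (inL2B sL TL))) lee_fin ltW//.
by apply: le_lt_trans sT; exact: ler_norm.
Unshelve. all: by end_near. Qed.

End decay.

(** * The relaxation step *)

Section contraction.
Context {R : realType} {a b T : R}.
Hypotheses (ab : a < b) (T0 : 0 < T).
Local Notation mu := (@lebesgue_measure R).

Lemma derive_within_cst (D : set R) (f : R -> R) (c x : R) : D x ->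
  ProperFilter (within D x^') -> {in D, forall y, f y = c} ->
  derivable_within D f x /\ derive_within D f x = 0.
Proof.
move=> Dx PF fc; apply: derive_withinP.
have : (fun=> 0 : R) y @[y --> within D x^'] --> (0 : R) by exact: cvg_cst.
apply: cvg_trans; apply: fmap_within_eq => y yD.
by rewrite /dslope (fc _ yD) (fc _ (mem_set Dx)) subrr mulr0.
Qed.

Lemma cst_fourier_mode : fourier_mode a b 0 (cst 1).
Proof.
have PF x : x \in `[a, b] -> ProperFilter (within `[a, b] x^').
  by apply: within_dnbhs_proper ab _; exact: subset_itv_oo_cc.
(* Only values on [a, b] are controlled: elsewhere the relative
   derivative of a constant is a limit along the trivial filter. *)
have D1 i : exists c : R, {in `[a, b]%classic, forall x,
    iter i (Dx a b) (cst 1) x = c} /\ (i != 0%N -> c = 0).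
  elim: i => [|i [c [ic _]]]; first by exists 1.
  exists 0; split=> // x; rewrite inE => xab.
  exact: (derive_within_cst _ _ _ _ xab (PF x xab) ic).2.
have D0 i x : x \in `[a, b] -> iter i.+1 (Dx a b) (cst 1) x = 0.
  by move=> xab; have [c [ic c0]] := D1 i.+1; rewrite (ic _ (mem_set xab)) c0.
split.
- split=> i _.
    move=> x xab; have [c [ic _]] := D1 i.
    exact: (derive_within_cst _ _ _ _ xab (PF x xab) ic).1.
  have [c [ic _]] := D1 i; apply: (@subspace_eq_continuous _ _ _ (cst c)).
    by move=> x xab; exact: esym (ic x xab).
  by move=> x; exact: cvg_cst.
- exists ((a + b) / 2); last exact: oner_neq0.
  by rewrite in_itv/= !midf_lt.
- move=> x xab; rewrite expr0n/= oppr0 mul0r.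
  by apply: (D0 1%N); exact: subset_itv_oo_cc.
- move=> x xab; have xab' : x \in `[a, b].
    by case: xab => ->; rewrite in_itv/= lexx ltW.
  by split; apply/eqP; rewrite mulf_eq0; apply/orP; right; apply/eqP;
    [exact: (D0 0%N)|exact: (D0 2%N)].
Qed.

Lemma lowest_fourier_frequency_eq0 (omega : R) :
  lowest_fourier_frequency a b omega -> omega = 0.
Proof.
move=> [_ /(_ 0)]; rewrite normr0 normr_le0 => omega0; apply/eqP/omega0.
by exists (cst 1); exact: cst_fourier_mode.
Qed.

(** [||v(0)|| <= |alpha| (||v(T)|| + ||w||)] and [||v(T)|| <= ||v(0)||]; as
    [|alpha| < 1], the term in [||v(0)||] can be absorbed on the left. *)
Lemma relaxation_contraction {alpha : R} {g : R -> R} {v : R -> R -> R}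
    {w : R -> R} {t : R} :
  `|alpha| < 1 -> biharmonic_heat_solution a b T g v -> inL2 a b w ->
  {ae mu, forall x, x \in `]a, b[ -> v 0 x = alpha * (v T x - w x)} ->
  t \in `[0, T] ->
  (L2norm a b (v t) <= (`|alpha| / (1 - `|alpha|))%:E * L2norm a b w)%E.
Proof.
move=> al1 sv wL v0 t0T; have [_ [vL _] _ _ _] := sv.
have v0L : inL2 a b (v 0) by apply: vL; rewrite in_itv/= lexx ltW.
have TT : T \in `[0, T] by rewrite in_itv/= lexx ltW.
have vTL : inL2 a b (v T) by exact: vL.
have wTL := inL2B vTL wL.
apply: le_trans (L2norm_nonincreasing ab T0 t sv t0T) _.
have vT := L2norm_nonincreasing ab T0 T sv TT.
have aL := inL2Z alpha wTL.
have : (L2norm a b (v 0%R) <= `|alpha|%:E * (L2norm a b (v T) + L2norm a b w))%E.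
  rewrite (L2norm_ae_eq v0L aL v0) L2normZ//.
  by apply: lee_wpmul2l; [rewrite lee_fin|exact: L2normB].
move: vT; have fin h : inL2 a b h -> {r : R | L2norm a b h = r%:E}.
  by move=> hL; exists (fine (L2norm a b h)); rewrite fineK ?L2norm_fin_num.
have [p ->] := fin _ v0L; have [q ->] := fin _ vTL; have [r ->] := fin _ wL.
rewrite -EFinD -!EFinM !lee_fin => qp pqr.
rewrite mulrAC ler_pdivlMr ?subr_gt0//.
have : `|alpha| * q <= `|alpha| * p by rewrite ler_wpM2l.
lra.
Qed.

End contraction.

(** * Convergence of the iteration *)

Theorem theorem2p2 (R : realType) (a b T alpha omega_min : R) (u0 : R -> R)
    (u : R -> R -> R) (uk : nat -> R -> R -> R)
    (hab : a < b) (hT : 0 < T) (halpha : `|alpha| < 1)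
    (hu : biharmonic_heat_solution a b T u0 u)
    (huk : pint_iteration a b T alpha u0 uk)
    (homega : lowest_fourier_frequency a b omega_min)
    (k : nat) (hk : (1 <= k)%N) :
  let e := fun (j : nat) (t x : R) => uk j t x - u t x in
  let rho := `|alpha| * expR (- omega_min ^+ 4 * T)
             / (1 - `|alpha| * expR (- omega_min ^+ 4 * T)) in
  (LinftyL2norm a b T (e k) <= (rho ^+ k)%:E * LinftyL2norm a b T (e 0%N))%E.
Proof.
pose e := fun (j : nat) (t x : R) => uk j t x - u t x.
pose rho := `|alpha| * expR (- omega_min ^+ 4 * T)
            / (1 - `|alpha| * expR (- omega_min ^+ 4 * T)).
change (LinftyL2norm a b T (e k) <=
  (rho ^+ k)%:E * LinftyL2norm a b T (e 0%N))%E.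
have rhoE : rho = `|alpha| / (1 - `|alpha|).
  rewrite /rho (lowest_fourier_frequency_eq0 hab _ homega).
  by rewrite expr0n/= oppr0 mul0r expR0 mulr1.
(* Otherwise [EFinM] would match the product hidden in the body of [rho]. *)
clearbody rho.
have rho0 : 0 <= rho by rewrite rhoE divr_ge0// subr_ge0 ltW.
have [[ukL0 uk0T] sol] := huk; have [_ [uL cu] _ _ _] := hu.
have TT : T \in `]0, T] by rewrite in_itv/= hT lexx.
have TT' : T \in `[0, T] by exact: subset_itv_oc_cc.
have eL0 t : t \in `]0, T] -> inL2 a b (e 0%N t).
  by move=> t0T; apply: inL2B; [exact: ukL0|apply: uL; exact: subset_itv_oc_cc].
have ukTL j : inL2 a b (uk j T).
  case: j => [|j]; first exact: ukL0.
  by have [_ [L _] _ _ _] := sol j.+1 isT; exact: L.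
have eTL j : inL2 a b (e j T) by apply: inL2B => //; exact: uL.
have step j t : t \in `[0, T] ->
    (L2norm a b (e j.+1 t) <= rho%:E * L2norm a b (e j T))%E.
  have se := biharmonic_heat_solutionB hab hT (sol j.+1 isT) hu.
  rewrite rhoE; apply: (relaxation_contraction hab hT halpha se (eTL j)).
  have [_ _ _ _ e0] := se.
  apply: (@filterS _ _ (ae_filter_ringOfSetsType _)) e0 => x /[apply] /= ->.
  by rewrite /e; ring.
have final j : (L2norm a b (e j T) <= (rho ^+ j)%:E * L2norm a b (e 0%N T))%E.
  elim: j => [|j IH]; first by rewrite expr0 mul1e.
  apply: le_trans (step j T TT') _; rewrite exprS EFinM -muleA.
  by apply: lee_wpmul2l; rewrite ?lee_fin.
have guess : (L2norm a b (e 0%N T) <= LinftyL2norm a b T (e 0%N))%E.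
  apply: L2norm_final_le => //.
  apply: (L2cvgB _ _ (ukTL 0%N) (uL _ TT') uk0T).
  - near=> t; apply: ukL0; rewrite in_itv/=; apply/andP; split.
      by near: t; exact: nbhs_left_gt.
    by near: t; exact: nbhs_left_le.
  - near=> t; apply: uL; rewrite in_itv/=; apply/andP; split.
      by near: t; exact: nbhs_left_ge.
    by near: t; exact: nbhs_left_le.
  - apply: cvg_trans (cu T TT'); apply: cvg_app => A /= nA.
    apply: filterS2 (lt_nbhsr hT) nA => s s0 sA sT.
    by apply: sA; rewrite /= in_itv/= !ltW.
case: k hk => // k _.
apply: (@le_trans _ _ ((rho ^+ k.+1)%:E * L2norm a b (e 0%N T))%E); last first.
  by apply: lee_wpmul2l; rewrite ?lee_fin ?exprn_ge0.
apply: LinftyL2norm_le.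
  by rewrite mule_ge0 ?lee_fin ?exprn_ge0 ?L2norm_ge0.
move=> t t0T; apply: le_trans (step k t (subset_itv_oo_cc t0T)) _.
by rewrite exprS EFinM -muleA; apply: lee_wpmul2l; rewrite ?lee_fin.
Unshelve. all: by end_near. Qed.
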